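(* Let $Z_1$ be the set of points $(x_1,x_2,y,z,w)$ with $x_1,x_2,y,w\in\mathbb{R}$, $z\in\{0,1\}$ and $$q_2x_2^2+ry^2+z\le w,\quad x_2=ax_1+by+cz,\quad gz\le y\le hz,\quad \ell_1\le x_1\le u_1,\quad \ell_2\le x_2\le u_2.$$ Put $\ell_a=\min\{a\ell_1,au_1\}$, $u_a=\max\{a\ell_1,au_1\}$, and $$\ell(x_1,z)=\max\Big\{\ell_a,\ \frac{ax_1-u_az}{1-z}\Big\},\qquad u(x_1,z)=\min\Big\{u_a,\ \frac{ax_1-\ell_az}{1-z}\Big\}.$$ Then the inequality $$w\ \ge\ q_2\Big(\frac1z-1\Big)\Big(\big(\ell(x_1,z)-x_2\big)_+^2+\big(x_2-u(x_1,z)\big)_+^2\Big)+q_2x_2^2+\frac{ry^2}{z}+z$$ is valid for the problem of minimizing $w+q_1x_1^2$ over $Z_1$; that is, it is satisfied by every point of $Z_1$.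
   Context: The data are real numbers $a,b,c,g,h,\ell_1,u_1,\ell_2,u_2$ and $q_1,q_2,r\ge0$. Notation: $(t)_+=\max\{t,0\}$ and $(t)_+^2=((t)_+)^2$. Convention for the endpoints. At $z=1$ the first term on the right-hand side of the inequality is read as $0$. At $z=0$, a term of the form $\alpha/z$ is read as $0$ if $\alpha=0$ and as $+\infty$ if $\alpha>0$, and $\big(\frac1z-1\big)\alpha$ is read as $\frac{(1-z)\alpha}{z}$. *)

(* Defs.v *)
From mathcomp Require Import all_boot all_order all_algebra.
From mathcomp Require Import all_classical all_reals.

Set Implicit Arguments.
Unset Strict Implicit.
Unset Printing Implicit Defensive.
Import Order.TTheory GRing.Theory Num.Theory.

Local Open Scope classical_set_scope.
Local Open Scope ring_scope.

Record mixed_point (R : realType) : Type :=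
  MixedPoint { x1 : R; x2 : R; y : R; z : R; w : R }.

Definition Z1 (R : realType) (a b c g h l1 u1 l2 u2 q2 r : R) :
    set (mixed_point R) :=
  [set p | [/\ z p = 0 \/ z p = 1,
               q2 * x2 p ^+ 2 + r * y p ^+ 2 + z p <= w p,
               x2 p = a * x1 p + b * y p + c * z p,
               g * z p <= y p <= h * z p &
               l1 <= x1 p <= u1 /\ l2 <= x2 p <= u2]].

Record minimization (T : Type) (R : realType) : Type :=
  Minimize { objective : T -> R; feasible : set T }.

(* Validity depends on the feasible set only, not on the objective. *)
Definition valid_inequality (T : Type) (R : realType)
    (P : minimization T R) (I : set T) : Prop :=
  feasible P `<=` I.

Definition problem (R : realType)
    (a b c g h l1 u1 l2 u2 q1 q2 r : R) : minimization (mixed_point R) R :=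
  Minimize (fun p => w p + q1 * x1 p ^+ 2) (Z1 a b c g h l1 u1 l2 u2 q2 r).

Definition pos_part (R : realType) (t : R) : R := Num.max t 0.

Definition l_a (R : realType) (a l1 u1 : R) : R := Num.min (a * l1) (a * u1).
Definition u_a (R : realType) (a l1 u1 : R) : R := Num.max (a * l1) (a * u1).

(* The values of [lower] and [upper] at zp = 1 (a division by zero) are
   never used: see [slack_term]. *)
Definition lower (R : realType) (a l1 u1 x1p zp : R) : R :=
  Num.max (l_a a l1 u1) ((a * x1p - u_a a l1 u1 * zp) / (1 - zp)).
Definition upper (R : realType) (a l1 u1 x1p zp : R) : R :=
  Num.min (u_a a l1 u1) ((a * x1p - l_a a l1 u1 * zp) / (1 - zp)).

(* Division below is that of \bar R, where 0^-1 = +oo and 0 * +oo = 0, so that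
   alpha / 0 is 0 if alpha = 0 and +oo if alpha > 0.  The factor (1/z - 1)
   applied to alpha is (1 - z) alpha / z, and the term is 0 at z = 1. *)
Definition slack_term (R : realType) (a l1 u1 q2 : R) (p : mixed_point R) : \bar R :=
  if z p == 1 then 0%E else
  let alpha := pos_part (lower a l1 u1 (x1 p) (z p) - x2 p) ^+ 2
             + pos_part (x2 p - upper a l1 u1 (x1 p) (z p)) ^+ 2 in
  (q2%:E * (((1 - z p) * alpha)%:E / (z p)%:E))%E.

Definition rhs (R : realType) (a l1 u1 q2 r : R) (p : mixed_point R) : \bar R :=
  (slack_term a l1 u1 q2 p + (q2 * x2 p ^+ 2)%:E
   + (r * y p ^+ 2)%:E / (z p)%:E + (z p)%:E)%E.

(* Main.v *)
Require Import Defs.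
From mathcomp Require Import all_boot all_order all_algebra.
From mathcomp Require Import all_classical all_reals.
Import Order.TTheory GRing.Theory Num.Theory.
Local Open Scope classical_set_scope.
Local Open Scope ring_scope.

(** Validity is tested at the two values of the binary variable [z].  At
    [z = 1] the slack term vanishes and the inequality is the defining
    constraint [q2 x2^2 + r y^2 + z <= w].  At [z = 0] the bounds on [y]
    force [y = 0], so the coupling equation gives [x2 = a x1]; since [a x1]
    lies between [l_a] and [u_a], both bounds [lower] and [upper] collapse to
    [a x1] ([lower_at0], [upper_at0]), so both positive parts vanish.  The two
    quotients with denominator [z] then have numerator [0], so they are [0],
    and the defining constraint remains. *)

(** [x1 |-> a x1] is monotone in one direction or the other according to the
    sign of [a], so it maps an interval between the images of its endpoints. *)
Lemma scaled_itv_bounds (R : realType) (a l u x : R) :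
  l <= x <= u -> l_a a l u <= a * x <= u_a a l u.
Proof.
move=> /andP[lx xu]; rewrite /l_a /u_a ge_min le_max.
have [a0|/ltW a0] := leP 0 a.
  by rewrite (ler_wpM2l a0 lx) (ler_wpM2l a0 xu) orbT.
by rewrite (ler_wnM2l a0 lx) (ler_wnM2l a0 xu) orbT.
Qed.

Lemma lower_at0 (R : realType) (a l u x : R) :
  l <= x <= u -> lower a l u x 0 = a * x.
Proof.
move=> /(scaled_itv_bounds _ a)/andP[lax _].
by rewrite /lower mulr0 !subr0 divr1; apply/max_idPr.
Qed.

Lemma upper_at0 (R : realType) (a l u x : R) :
  l <= x <= u -> upper a l u x 0 = a * x.
Proof.
move=> /(scaled_itv_bounds _ a)/andP[_ axu].
by rewrite /upper mulr0 !subr0 divr1; apply/min_idPr.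
Qed.

Theorem corollary5 (R : realType) (a b c g h l1 u1 l2 u2 q1 q2 r : R)
    (hq1 : 0 <= q1) (hq2 : 0 <= q2) (hr : 0 <= r) :
  valid_inequality (problem a b c g h l1 u1 l2 u2 q1 q2 r)
    [set p : mixed_point R | ((w p)%:E >= rhs a l1 u1 q2 r p)%E].
Proof.
move=> [X1 X2 Y Z W] [/= Z01 cone link Ybd [X1bd _]].
rewrite /rhs /slack_term /=; case: Z01 => Z_eq; subst Z; last first.
  by rewrite eqxx inve1 mule1 add0e -!EFinD lee_fin.
have Y0 : Y = 0 by apply/eqP; rewrite eq_le andbC; move: Ybd; rewrite !mulr0.
have X2E : X2 = a * X1 by rewrite link Y0 !mulr0 !addr0.
rewrite eq_sym oner_eq0 lower_at0 // upper_at0 // X2E subrr /pos_part maxxx.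
rewrite Y0 expr0n /= !addr0 !mulr0 !mul0e mule0 add0e !adde0 lee_fin.
by move: cone; rewrite X2E Y0 expr0n /= mulr0 !addr0.
Qed.
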